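(* Let $P$ be the uniform distribution on the square region $J=[0,1]\times[0,1]$ with vertices $(0,0),(1,0),(1,1),(0,1)$. Then there are exactly two optimal sets of two-means for $P$, namely $\{(\frac14,\frac12),(\frac34,\frac12)\}$ and $\{(\frac12,\frac14),(\frac12,\frac34)\}$, and the quantization error is $V_2(P)=\frac{5}{48}$.
   Context: The uniform distribution on $J$ is the Borel probability measure with density $1$ on $J$ and $0$ elsewhere with respect to Lebesgue measure. For a Borel probability measure $P$ on $\mathbb R^d$ and $n\ge1$, the $n$th quantization error is $V_n(P)=\inf\{\int \min_{a\in\alpha}\|x-a\|^2\,dP(x):\alpha\subset\mathbb R^d,\ \mathrm{card}(\alpha)\le n\}$, where $\|\cdot\|$ is the Euclidean norm. A set $\alpha$ with $\mathrm{card}(\alpha)\le n$ attaining the infimum is called an optimal set of $n$-means; for absolutely continuous $P$ it has exactly $n$ elements. *)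

(* Defs.v *)
From HB Require Import structures.
From mathcomp Require Import all_boot all_order all_algebra finmap.
From mathcomp Require Import all_classical all_reals all_analysis.
From mathcomp Require Import measurable_realfun.

Set Implicit Arguments.
Unset Strict Implicit.
Unset Printing Implicit Defensive.
Import Order.TTheory GRing.Theory Num.Theory.
Import numFieldNormedType.Exports.

Local Open Scope classical_set_scope.
Local Open Scope ring_scope.

(* [measurableTypeR R] is R with its Borel sigma-algebra, the one on which
   [lebesgue_measure] is a measure, so [plane R] is R * R with the product
   sigma-algebra, i.e., the Borel sigma-algebra of the plane. *)
Notation plane R := (measurableTypeR R * measurableTypeR R)%type.

Section Quantization.
Context {R : realType}.

(* The norm that the library puts on R * R is the sup norm. *)
Definition euclid_norm (z : R * R) : R := Num.sqrt (z.1 ^+ 2 + z.2 ^+ 2).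

Definition sqdist (x a : R * R) : R := euclid_norm (x - a) ^+ 2.

Implicit Types (P : probability (plane R) R) (alpha : {fset R * R}) (n : nat).

(* A minimum over the empty set is +oo, so that the empty set, although its
   cardinality is at most n, does not contribute to the infimum below. *)
Definition distortion P alpha : \bar R :=
  (\int[P]_x \big[Order.min/+oo]_(a <- alpha) (sqdist x a)%:E)%E.

Definition quantization_error n P : \bar R :=
  ereal_inf [set distortion P alpha | alpha in [set alpha | (#|` alpha| <= n)%N]].

Definition optimal_means n P : set {fset R * R} :=
  [set alpha | (#|` alpha| <= n)%N /\ distortion P alpha = quantization_error n P].

End Quantization.

Section UniformSquare.
Context {R : realType}.

Definition unit_square : set (plane R) := `[0, 1] `*` `[0, 1].

Definition uniform_square (A : set (plane R)) : \bar R :=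
  (\int[@lebesgue_measure R \x @lebesgue_measure R]_(z in A)
     (\1_unit_square z)%:E)%E.

Let measurable_square : measurable unit_square.
Proof. exact: measurableX. Qed.

Let uniform0 : uniform_square set0 = 0%E.
Proof. by rewrite /uniform_square integral_set0. Qed.

Let uniform_ge0 A : (0 <= uniform_square A)%E.
Proof. by apply: integral_ge0 => z _; rewrite lee_fin. Qed.

Let uniform_sigma_additive : semi_sigma_additive uniform_square.
Proof.
move=> F mF tF mUF; rewrite /uniform_square; apply: cvg_toP.
  apply: ereal_nondecreasing_is_cvgn => m n mn.
  apply: lee_sum_nneg_natr => // k _ _.
  exact: uniform_ge0.
rewrite ge0_integral_bigcup//=.
by apply: measurable_funTS; apply/measurable_EFinP; exact: measurable_indic.
Qed.

HB.instance Definition _ := isMeasure.Build _ _ _ uniform_square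
  uniform0 uniform_ge0 uniform_sigma_additive.

Let uniform_setT : uniform_square [set: _] = 1%:E.
Proof.
rewrite /uniform_square integral_indic// setIT.
apply: etrans (product_measure1E _ _ _ _) _ => //=.
rewrite !lebesgue_measure_itv/= lte_fin ltr01.
by rewrite oppr0 adde0 mule1.
Qed.

HB.instance Definition _ := @Measure_isProbability.Build _ _ R
  uniform_square uniform_setT.

End UniformSquare.

(* Main.v *)
Require Import Defs.
From mathcomp Require Import all_boot all_order all_algebra finmap.
From mathcomp Require Import all_classical all_reals all_analysis.
From mathcomp Require Import measurable_realfun ring lra.

(* Write a = m - d and b = m + d, with m = c + u and c the center of the square.
   Pointwise, min (|x - a|^2, |x - b|^2) = |x - m|^2 + |d|^2 - 2 |d.(x - m)|, so
   the distortion of {a, b} is 1/6 + |u|^2 + |d|^2 - 2 F, where F is the mean of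
   the absolute value of the affine form d.(x - c) - u.d.  The key fact is
     F^2 <= (u.d)^2 + |d|^2 / 16,
   with equality, for d <> 0, only if u.d = 0 and d is parallel to an axis;
   it is obtained by integrating first along the larger coordinate of d.  By
   Cauchy-Schwarz F^2 <= |d|^2 (|u|^2 + 1/16), and AM-GM gives
   2 F <= |d|^2 + |u|^2 + 1/16, i.e., a distortion of at least
   1/6 - 1/16 = 5/48; equality forces u = 0 and |d| = 1/4.
   No Voronoi partition of the square has to be discussed. *)

Import Order.TTheory GRing.Theory Num.Theory.
Import numFieldNormedType.Exports.

Local Open Scope classical_set_scope.
Local Open Scope ring_scope.

(** * Integrals over an interval of the line *)

Section OneDim.
Context {R : realType}.
Local Notation mu := (@lebesgue_measure R).

Lemma integral_itv_quadratic (a b u v w : R) : a < b ->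
  (\int[mu]_(x in `[a, b]) (u * x ^+ 2 + v * x + w)%:E =
   (u / 3 * (b ^+ 3 - a ^+ 3) + v / 2 * (b ^+ 2 - a ^+ 2) + w * (b - a))%:E)%E.
Proof.
move=> ab.
pose F (x : R) : R := u / 3 * x ^+ 3 + v / 2 * x ^+ 2 + w * x.
have dF (x : R) : is_derive x 1 F (u * x ^+ 2 + v * x + w).
  by apply: is_derive_eq; rewrite /GRing.scale /=; field.
have cF : continuous F.
  move=> x; apply: differentiable_continuous; apply/derivable1_diffP.
  by have [] := dF x.
rewrite (@continuous_FTC2 _ _ F)//.
- by rewrite -EFinB /F; congr EFin; ring.
- apply: continuous_subspaceT => x.
  by apply: cvgD; [apply: cvgD|exact: cvg_cst];
    apply: cvgM; rewrite /=; try exact: cvg_cst;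
    try exact: exprn_continuous; exact: cvg_id.
- split => [x _||].
  + by have [] := dF x.
  + exact/cvg_at_right_filter/cF.
  + exact/cvg_at_left_filter/cF.
- by move=> x _; rewrite derive1E; have [_ ->] := dF x.
Qed.

Lemma integral_itv_eq_affine (a b v w : R) (f : R -> R) : a < b ->
  {in `[a, b], forall x, f x = v * x + w} ->
  (\int[mu]_(x in `[a, b]) (f x)%:E =
   (v / 2 * (b ^+ 2 - a ^+ 2) + w * (b - a))%:E)%E.
Proof.
move=> ab fE.
transitivity (\int[mu]_(x in `[a, b]) (0 * x ^+ 2 + v * x + w)%:E)%E.
  by apply: eq_integral => x; rewrite inE/= => /fE ->; rewrite mul0r add0r.
by rewrite integral_itv_quadratic// !mul0r add0r.
Qed.

Lemma integral_itv_normB (s : R) :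
  (\int[mu]_(x in `[0%R, 1%R]) `|x - s|%:E =
   (if `|s - 2^-1| <= 2^-1 then 4^-1 + (s - 2^-1) ^+ 2 else `|s - 2^-1|)%:E)%E.
Proof.
have [s0|s0] := leP s 0.
  rewrite ler0_norm; last lra.
  rewrite (@integral_itv_eq_affine _ _ 1 (- s))//.
    (* The case s <= 0 meets the first branch of the formula only at s = 0, where both branches give
       1/2; likewise below at s = 1. *)
    case: ifPn => h; congr EFin; last by field.
    have -> : s = 0 by lra.
    by field.
  by move=> x; rewrite in_itv/= => /andP[x0 x1]; rewrite ger0_norm; lra.
have [s1|s1] := leP 1 s.
  rewrite [X in X <= _]ger0_norm; last lra.
  rewrite (@integral_itv_eq_affine _ _ (-1) s)//.
    rewrite ger0_norm; last lra.
    case: ifPn => h; congr EFin; last by field.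
    have -> : s = 1 by lra.
    by field.
  by move=> x; rewrite in_itv/= => /andP[x0 x1]; rewrite ler0_norm; lra.
rewrite ifT; last by rewrite ler_norml; apply/andP; split; lra.
have mf (D : set (measurableTypeR R)) : measurable_fun D (fun x => `|x - s|%:E).
  apply/measurable_EFinP/measurable_funTS/measurableT_comp => //.
  exact: measurable_funB.
(* For 0 < s < 1 the interval is cut at the kink s; the integrand is affine on each piece. *)
have -> : `[0, 1]%classic = `[0, s] `|` `]s, 1] :> set (measurableTypeR R).
  by rewrite (@itv_bndbnd_setU _ R (BLeft 0) (BRight s) (BRight 1))//
    bnd_simp ltW.
rewrite ge0_integral_setU//=; last first.
  rewrite disj_set2E; apply/eqP/seteqP; split => // x /= [].
  by rewrite !in_itv/= => /andP[_ h] /andP[]; rewrite ltNge h.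
rewrite [X in (_ + X)%E](@integral_itv_obnd_cbnd R s (BRight 1)); last exact: mf.
rewrite (@integral_itv_eq_affine _ _ (-1) s)//; last first.
  by move=> x; rewrite in_itv/= => /andP[x0 x1]; rewrite ler0_norm; lra.
rewrite (@integral_itv_eq_affine _ _ 1 (- s))//; last first.
  by move=> x; rewrite in_itv/= => /andP[x0 x1]; rewrite ger0_norm; lra.
by rewrite -EFinD; congr EFin; field.
Qed.

End OneDim.

(** * The uniform law on the square as a product, and means over [0, 1] *)

Section UnitInterval.
Context {R : realType}.
Local Notation U := (@uniform_prob R 0 1 ltr01).

(** A product measure is determined by its values on rectangles, and on [B] x [C] both sides are the
    product of the lengths of [B] and [C] cut down to [0, 1]. *)
Lemma uniform_squareE (A : set (plane R)) : measurable A ->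
  uniform_square A = (U \x U)%E A.
Proof.
move=> mA; apply/esym.
apply: (@product_measure_unique _ _ _ _ R U U uniform_square) => // B C mB mC.
transitivity (\int[@lebesgue_measure R \x @lebesgue_measure R]_(z in B `*` C)
    (\1_unit_square z)%:E)%E => //.
rewrite integral_indic//=; last first.
- exact: measurableX.
- exact: measurableX.
rewrite /unit_square setIC -setXI.
apply: etrans (product_measure1E _ _ _ _) _;
  [exact: measurableI|exact: measurableI|].
have UE (D : set (measurableTypeR R)) : measurable D ->
    U D = lebesgue_measure (D `&` `[0, 1]).
  move=> mD; rewrite /uniform_prob integral_uniform_pdf.
  rewrite (eq_integral (fun=> 1%E)); last first.
    move=> x; rewrite inE/= in_itv/= /uniform_pdf => -[_ ->].
    by rewrite subr0 invr1.
  by rewrite integral_cst ?mul1e//; exact: measurableI.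
by rewrite !UE.
Qed.

Lemma integral_uniform_square1 (f : plane R -> \bar R) :
  measurable_fun setT f -> (forall z, 0 <= f z)%E ->
  (\int[uniform_square]_z f z = \int[U]_x \int[U]_y f (x, y))%E.
Proof.
move=> mf f0; rewrite -(fubini_tonelli1 (m1 := U) (m2 := U) f mf f0).
by apply: eq_measure_integral => A mA _; exact: uniform_squareE.
Qed.

Lemma integral_uniform_square2 (f : plane R -> \bar R) :
  measurable_fun setT f -> (forall z, 0 <= f z)%E ->
  (\int[uniform_square]_z f z = \int[U]_y \int[U]_x f (x, y))%E.
Proof.
move=> mf f0; rewrite -(fubini_tonelli2 (m1 := U) (m2 := U) f mf f0).
by apply: eq_measure_integral => A mA _; exact: uniform_squareE.
Qed.

(** Centered at 1/2, the linear term has mean 0 and the square has mean 1/12, the variance of the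
    uniform law. *)
Lemma integral_uniform_quadratic (u v w : R) :
  (forall x, 0 <= u * (x - 2^-1) ^+ 2 + v * (x - 2^-1) + w) ->
  (\int[U]_x (u * (x - 2^-1) ^+ 2 + v * (x - 2^-1) + w)%:E = (u / 12 + w)%:E)%E.
Proof.
move=> ge0; rewrite integral_uniform//; last first.
- apply/measurable_EFinP/measurable_funD => //; apply: measurable_funD.
    apply: measurable_funM => //.
    by apply: measurable_funX; exact: measurable_funB.
  by apply: measurable_funM => //; exact: measurable_funB.
rewrite subr0 invr1 mul1e.
transitivity (\int[@lebesgue_measure R]_(x in `[0%R, 1%R])
   (u * x ^+ 2 + (v - u) * x + (u / 4 - v / 2 + w))%:E)%E.
  by apply: eq_integral => x _; congr EFin; field.
by rewrite integral_itv_quadratic//; congr EFin; field.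
Qed.

(* The mean of |p (x - 1/2) + k| for x uniform on [0, 1]; for p = 0 the junk
   value x / 0 = 0 makes the formula correct. *)
Definition mean_norm (p k : R) : R :=
  if `|k| <= `|p| / 2 then `|p| / 4 + k ^+ 2 / `|p| else `|k|.

Lemma integral_uniform_norm (p k : R) :
  (\int[U]_x `|p * (x - 2^-1) + k|%:E = (mean_norm p k)%:E)%E.
Proof.
have [->|p0] := eqVneq p 0.
  under eq_integral do rewrite mul0r add0r.
  rewrite integral_cst//= probability_setT mule1 /mean_norm normr0.
  rewrite !mul0r add0r invr0 mulr0.
  by case: ifPn => //; rewrite normr_le0 => /eqP ->; rewrite normr0.
rewrite integral_uniform//; last first.
  apply/measurable_EFinP/measurableT_comp => //; apply: measurable_funD => //.
  by apply: measurable_funM => //; exact: measurable_funB.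
rewrite subr0 invr1 mul1e.
(* Factoring out |p| leaves the mean distance to the zero 1/2 - k / p of the affine form. *)
transitivity (\int[@lebesgue_measure R]_(x in `[0%R, 1%R])
   (`|p|%:E * `|x - (2^-1 - k / p)|%:E))%E.
  apply: eq_integral => x _; rewrite -EFinM -normrM; congr (`| _ |%:E).
  by field.
rewrite ge0_integralZl//; last first.
  apply/measurable_EFinP/measurable_funTS/measurableT_comp => //.
  exact: measurable_funB.
rewrite integral_itv_normB -EFinM /mean_norm; congr EFin.
have -> : 2^-1 - k / p - 2^-1 = - (k / p) by ring.
have np : 0 < `|p| by rewrite normr_gt0.
rewrite normrN normf_div ler_pdivrMr// [2^-1 * _]mulrC.
case: ifPn => _; last by rewrite mulrC divfK// gt_eqF.
rewrite sqrrN expr_div_n -(real_normK (num_real p)).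
by field; rewrite gt_eqF.
Qed.

End UnitInterval.

(** * Upper bounds for the mean absolute value of an affine form on the square *)

Section MeanNormAffine.
Context {R : realType}.
Local Notation U := (@uniform_prob R 0 1 ltr01).

(** This is F for d = (p, q); here [c] is the constant term of the form, later -u.d, and not the
    center of the square. The value lies in [\bar R]; that it is finite will follow from the upper
    bounds. *)
Definition mean_affine (p q c : R) : \bar R :=
  (\int[uniform_square]_(z in [set: plane R])
     `|p * (z.1 - 2^-1) + q * (z.2 - 2^-1) + c|%:E)%E.

Lemma mean_norm_ge0 (p k : R) : 0 <= mean_norm p k.
Proof.
rewrite /mean_norm; case: ifP => // _.
by rewrite addr_ge0// divr_ge0// sqr_ge0.
Qed.

(** The first branch of [mean_norm] is the right-hand side itself, and it exceeds |k| by the square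
    (|p| / 2 - |k|)^2 / |p|. *)
Lemma mean_norm_le_square (p k : R) : p != 0 ->
  mean_norm p k <= `|p| / 4 + k ^+ 2 / `|p|.
Proof.
rewrite /mean_norm -normr_gt0; case: ifP => // _ p0.
rewrite -subr_ge0 -(real_normK (num_real k)).
have -> : `|p| / 4 + `|k| ^+ 2 / `|p| - `|k| = (`|p| / 2 - `|k|) ^+ 2 / `|p|.
  by field; rewrite gt_eqF.
by rewrite divr_ge0// sqr_ge0.
Qed.

(* Unlike [mean_norm_le_square], this is sharp at k = c, where the affine form has
   constant sign. *)
Lemma mean_norm_le_norm (p k c : R) : p != 0 -> `|p| / 2 <= `|c| ->
  mean_norm p k <= `|k| + `|p| / (4 * c ^+ 2) * (k - c) ^+ 2.
Proof.
rewrite /mean_norm -normr_gt0 => p0 pc.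
have c0 : 0 < `|c| by lra.
have cn0 : c != 0 by rewrite -normr_gt0.
have c20 : 0 < c ^+ 2 by rewrite exprn_even_gt0.
case: ifP => [kp|_]; last first.
  by rewrite lerDl mulr_ge0 ?sqr_ge0// divr_ge0// mulr_ge0// ltW.
rewrite -subr_ge0.
set a := `|p| in p0 pc kp *.
(* As a difference of two squares, the gap is nonnegative once |c| (a - 2 |k|) <= a |k - c|. This
   follows from |c| - |k| <= |k - c| and a <= 2 |c|. *)
have -> : `|k| + a / (4 * c ^+ 2) * (k - c) ^+ 2 - (a / 4 + k ^+ 2 / a) =
    ((a * (k - c)) ^+ 2 - (c * (a - 2 * `|k|)) ^+ 2) / (4 * a * c ^+ 2).
  rewrite -[in LHS](real_normK (num_real k)) [in RHS]exprMn [in RHS]exprMn.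
  by field; rewrite cn0 gt_eqF.
apply: divr_ge0; last by nra.
rewrite subr_ge0 -[leLHS]real_normK ?num_real// -[leRHS]real_normK ?num_real//.
rewrite ler_sqr ?nnegrE// !normrM (gtr0_norm p0).
rewrite (@ger0_norm _ (a - 2 * `|k|)); last lra.
have : `|c| - `|k| <= `|k - c| by rewrite distrC; exact: lerB_dist.
move=> /(ler_wpM2l (ltW p0)); apply: le_trans.
have := normr_ge0 k; nra.
Qed.

Lemma measurable_norm_affine (p q c : R) : measurable_fun [set: plane R]
  (fun z : plane R => `|p * (z.1 - 2^-1) + q * (z.2 - 2^-1) + c|).
Proof.
apply: measurableT_comp => //; apply: measurable_funD => //.
by apply: measurable_funD; apply: measurable_funM => //;
  apply: measurable_funB.
Qed.

Lemma mean_affineC (p q c : R) : mean_affine p q c = mean_affine q p c.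
Proof.
have mf := measurable_norm_affine.
rewrite /mean_affine integral_uniform_square1 ?integral_uniform_square2//;
  try by [apply/measurable_EFinP; exact: mf | move=> z; rewrite lee_fin].
apply: eq_integral => x _; apply: eq_integral => y _ /=.
by rewrite [q * _ + _]addrC.
Qed.

Lemma mean_affineE (p q c : R) :
  mean_affine p q c = (\int[U]_y (mean_norm p (q * (y - 2^-1) + c))%:E)%E.
Proof.
rewrite /mean_affine integral_uniform_square2//; last first.
  by apply/measurable_EFinP; exact: measurable_norm_affine.
apply: eq_integral => y _ /=; rewrite -integral_uniform_norm.
by apply: eq_integral => x _; rewrite addrA.
Qed.

(** The function is a partial integral of a nonnegative measurable function, hence measurable by
    Tonelli's theorem; its two branches need not be separated. *)
Lemma measurable_mean_norm (p q c : R) :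
  measurable_fun setT
    (fun y : measurableTypeR R => (mean_norm p (q * (y - 2^-1) + c))%:E).
Proof.
pose f (z : plane R) := `|p * (z.1 - 2^-1) + q * (z.2 - 2^-1) + c|%:E.
have /measurable_fun_fubini_tonelli_G : measurable_fun setT f.
  by apply/measurable_EFinP; exact: measurable_norm_affine.
move=> /(_ U); rewrite (_ : fubini_G _ _ =
    fun y : measurableTypeR R => (mean_norm p (q * (y - 2^-1) + c))%:E).
  by apply => z; rewrite lee_fin.
apply/funext => y; rewrite /fubini_G -integral_uniform_norm.
by apply: eq_integral => x _; rewrite /f addrA.
Qed.

(** The pointwise bound [mean_norm_le_square] at k = q (y - 1/2) + c is a quadratic in y - 1/2,
    whose mean is explicit. *)
Lemma mean_affine_le_square (p q c : R) : p != 0 ->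
  (mean_affine p q c <= (`|p| / 4 + (q ^+ 2 / 12 + c ^+ 2) / `|p|)%:E)%E.
Proof.
move=> p0; have p_gt0 : 0 < `|p| by rewrite normr_gt0.
pose u := q ^+ 2 / `|p|; pose v := 2 * q * c / `|p|.
pose w := `|p| / 4 + c ^+ 2 / `|p|.
have E (y : R) : `|p| / 4 + (q * (y - 2^-1) + c) ^+ 2 / `|p| =
    u * (y - 2^-1) ^+ 2 + v * (y - 2^-1) + w.
  by rewrite /u /v /w; field; rewrite gt_eqF.
have -> : `|p| / 4 + (q ^+ 2 / 12 + c ^+ 2) / `|p| = u / 12 + w.
  by rewrite /u /w; field; rewrite gt_eqF.
rewrite -(@integral_uniform_quadratic R u v); last first.
  by move=> y; rewrite -E addr_ge0// divr_ge0// sqr_ge0.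
rewrite mean_affineE; apply: ge0_le_integral => //.
- by move=> y _; rewrite lee_fin mean_norm_ge0.
- exact: measurable_mean_norm.
- apply/measurable_EFinP/measurable_funD => //; apply: measurable_funD.
    apply: measurable_funM => //.
    by apply: measurable_funX; exact: measurable_funB.
  by apply: measurable_funM => //; exact: measurable_funB.
- by move=> y _; rewrite -E lee_fin; exact: mean_norm_le_square.
Qed.

(* The average of |q (y - 1/2) + c| is |c| since |q| / 2 <= |c|. *)
Lemma mean_affine_le_norm (p q c : R) :
  p != 0 -> `|q| <= `|p| -> `|p| / 2 <= `|c| ->
  (mean_affine p q c <= (`|c| + `|p| * q ^+ 2 / (48 * c ^+ 2))%:E)%E.
Proof.
move=> p0 qp pc; have p_gt0 : 0 < `|p| by rewrite normr_gt0.
have c0 : c != 0 by rewrite -normr_gt0; lra.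
pose u := `|p| * q ^+ 2 / (4 * c ^+ 2).
have u0 : 0 <= u by apply: divr_ge0; apply: mulr_ge0 => //; exact: sqr_ge0.
have mu2 : measurable_fun [set: measurableTypeR R]
    (fun y : measurableTypeR R => u * (y - 2^-1) ^+ 2 + 0 * (y - 2^-1) + 0).
  apply: measurable_funD => //; apply: measurable_funD.
    apply: measurable_funM => //.
    by apply: measurable_funX; exact: measurable_funB.
  by apply: measurable_funM => //; exact: measurable_funB.
have mk : measurable_fun [set: measurableTypeR R]
    (fun y : measurableTypeR R => `|q * (y - 2^-1) + c|).
  apply: measurableT_comp => //; apply: measurable_funD => //.
  by apply: measurable_funM => //; exact: measurable_funB.
have -> : `|c| + `|p| * q ^+ 2 / (48 * c ^+ 2) = mean_norm q c + (u / 12 + 0).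
  (* The first branch requires |c| <= |q| / 2, which leaves only |q| = 2 |c|; there its value is
     again |c|. *)
  rewrite /mean_norm; case: ifPn => h; last by rewrite /u; field.
  have cq : `|q| = 2 * `|c| by lra.
  rewrite cq -(real_normK (num_real c)) /u -(real_normK (num_real c)).
  by field; rewrite normr_eq0.
have ge0 y : 0 <= u * (y - 2^-1) ^+ 2 + 0 * (y - 2^-1) + 0.
  by rewrite mul0r !addr0 mulr_ge0// sqr_ge0.
rewrite EFinD -integral_uniform_norm -(@integral_uniform_quadratic R u 0 0)//.
rewrite -ge0_integralD//; last 3 first.
- exact/measurable_EFinP.
- by move=> y _; rewrite lee_fin.
- exact/measurable_EFinP.
rewrite mean_affineE; apply: ge0_le_integral => //.
- by move=> y _; rewrite lee_fin mean_norm_ge0.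
- exact: measurable_mean_norm.
- by apply/measurable_EFinP; exact: measurable_funD.
- move=> y _; rewrite lee_fin.
  apply: le_trans (@mean_norm_le_norm p _ c p0 pc) _.
  rewrite addrK mul0r !addr0 lerD2l le_eqVlt; apply/orP; left; apply/eqP.
  by rewrite /u; field.
Qed.

End MeanNormAffine.

(** * The key inequality on F and its equality case *)

Section Bound.
Context {R : realType}.

(** Integration runs first along the dominant coordinate p. The square bound serves when |c| <= |p|
    / 2 and the norm bound otherwise, where the inequality is strict. *)
Lemma mean_affine_bound_dominant (p q c : R) : p != 0 -> `|q| <= `|p| ->
  exists F, [/\ mean_affine p q c = F%:E, 0 <= F,
    F ^+ 2 <= c ^+ 2 + (p ^+ 2 + q ^+ 2) / 16 &
    F ^+ 2 = c ^+ 2 + (p ^+ 2 + q ^+ 2) / 16 -> c = 0 /\ q = 0].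
Proof.
move=> p0 qp.
have a0 : 0 < `|p| by rewrite normr_gt0.
have M0 : (0%E <= mean_affine p q c)%E.
  by apply: integral_ge0 => z _; rewrite lee_fin.
have q0 := normr_ge0 q; have c0 := normr_ge0 c.
rewrite -(real_normK (num_real p)) -(real_normK (num_real q)).
rewrite -(real_normK (num_real c)).
(* An upper bound [B] of the mean suffices: equality for F squeezes B^2 between F^2 and the
   right-hand side, so that it passes to [B]. *)
suff [B mB [BE Bi]] : exists2 B, (mean_affine p q c <= B%:E)%E &
    B ^+ 2 <= `|c| ^+ 2 + (`|p| ^+ 2 + `|q| ^+ 2) / 16 /\
    (B ^+ 2 = `|c| ^+ 2 + (`|p| ^+ 2 + `|q| ^+ 2) / 16 -> `|c| = 0 /\ `|q| = 0).
  move: M0 mB; case: (mean_affine p q c) => [F| |]//; rewrite !lee_fin => F0 FB.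
  have FB2 : F ^+ 2 <= B ^+ 2 by rewrite ler_sqr ?nnegrE//; exact: le_trans FB.
  exists F; split => //; first exact: le_trans BE.
  move=> FE; suff [/eqP + /eqP] : `|c| = 0 /\ `|q| = 0.
    by rewrite !normr_eq0 => /eqP -> /eqP ->.
  by apply: Bi; apply/eqP; rewrite eq_le BE -FE FB2.
have [cp|pc] := leP `|c| (`|p| / 2).
  exists (`|p| / 4 + (q ^+ 2 / 12 + c ^+ 2) / `|p|).
    exact: mean_affine_le_square.
  rewrite -(real_normK (num_real q)) -(real_normK (num_real c)).
  move: a0 qp cp q0 c0.
  move: `|p| `|q| `|c| => {M0 p0 p q c} p q c p0 qp cp q0 c0.
  set T := _ + _ / 16.
  set B := _ + _ / p.
  have q2p2 : q ^+ 2 <= p ^+ 2 by nra.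
  have c2p2 : 4 * c ^+ 2 <= p ^+ 2 by nra.
  (* Every term on the right is nonnegative as q <= p and 2 c <= p. The terms in p^2 q^2 and p^2 c^2
     force q = c = 0 in case of equality. *)
  have E : p ^+ 2 * (T - B ^+ 2) =
     (p ^+ 2 - 4 * c ^+ 2) * c ^+ 2 / 4 + (p ^+ 2 - q ^+ 2) * q ^+ 2 / 144 +
     p ^+ 2 * q ^+ 2 / 72 + c ^+ 2 * (p ^+ 2 - q ^+ 2) / 6 + p ^+ 2 * c ^+ 2 / 12.
    by rewrite /T /B; field; rewrite gt_eqF.
  have h1 : 0 <= (p ^+ 2 - 4 * c ^+ 2) * c ^+ 2.
    by rewrite mulr_ge0 ?sqr_ge0//; lra.
  have h2 : 0 <= (p ^+ 2 - q ^+ 2) * q ^+ 2 by rewrite mulr_ge0 ?sqr_ge0//; lra.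
  have h3 : 0 <= c ^+ 2 * (p ^+ 2 - q ^+ 2) by rewrite mulr_ge0 ?sqr_ge0//; lra.
  have h4 : 0 <= p ^+ 2 * q ^+ 2 by rewrite mulr_ge0 ?sqr_ge0.
  have h5 : 0 <= p ^+ 2 * c ^+ 2 by rewrite mulr_ge0 ?sqr_ge0.
  have p20 : 0 < p ^+ 2 by rewrite exprn_gt0.
  split.
    by rewrite -subr_ge0 -(pmulr_rge0 _ p20) E; lra.
  move=> BT; move: E; rewrite BT subrr mulr0 => E.
  have : p ^+ 2 * q ^+ 2 == 0 by apply/eqP; lra.
  rewrite mulf_eq0 !sqrf_eq0 (gt_eqF p0)/= => /eqP ->; split => //.
  have : p ^+ 2 * c ^+ 2 == 0 by apply/eqP; lra.
  by rewrite mulf_eq0 !sqrf_eq0 (gt_eqF p0)/= => /eqP.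
exists (`|c| + `|p| * q ^+ 2 / (48 * c ^+ 2)).
  by apply: mean_affine_le_norm => //; exact: ltW.
rewrite -(real_normK (num_real q)) -(real_normK (num_real c)).
move: a0 qp pc q0 c0.
move: `|p| `|q| `|c| => {M0 p0 p q c} p q c p0 qp cp q0 c0.
suff : (c + p * q ^+ 2 / (48 * c ^+ 2)) ^+ 2 < c ^+ 2 + (p ^+ 2 + q ^+ 2) / 16.
  by move=> h; split; [exact: ltW|move=> e; move: h; rewrite e ltxx].
have cgt0 : 0 < c by lra.
(* The ratios p / c and q / c are at most 2, so the factor of q^2 is at most 2/24 + 16/2304 =
   13/144. As q <= p and p > 0, q^2 times 13/144 is less than (p^2 + q^2) / 16. *)
have -> : (c + p * q ^+ 2 / (48 * c ^+ 2)) ^+ 2 =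
    c ^+ 2 + q ^+ 2 * ((p / c) / 24 + ((p / c) * (q / c)) ^+ 2 / 2304).
  by field; rewrite gt_eqF.
rewrite ltrD2l.
have pc0 : 0 < p / c by rewrite divr_gt0.
have pc2 : p / c <= 2 by rewrite ler_pdivrMr//; lra.
have qc0 : 0 <= q / c by rewrite divr_ge0// ltW.
have qc2 : q / c <= 2 by rewrite ler_pdivrMr//; lra.
have h1 : (p / c) * (q / c) <= 4 by nra.
have h2 : 0 <= (p / c) * (q / c) by nra.
have h3 : ((p / c) * (q / c)) ^+ 2 <= 16 by nra.
have q20 := sqr_ge0 q.
have : q ^+ 2 * (p / c / 24 + (p / c * (q / c)) ^+ 2 / 2304) <=
    q ^+ 2 * (13 / 144).
  by apply: ler_wpM2l => //; lra.
by move=> /le_lt_trans; apply; nra.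
Qed.

(** By the symmetry [mean_affineC] either coordinate may play the dominant role; the other one
    vanishes in case of equality. *)
Lemma mean_affine_bound (p q c : R) : (p, q) != 0 ->
  exists F, [/\ mean_affine p q c = F%:E, 0 <= F,
    F ^+ 2 <= c ^+ 2 + (p ^+ 2 + q ^+ 2) / 16 &
    F ^+ 2 = c ^+ 2 + (p ^+ 2 + q ^+ 2) / 16 -> c = 0 /\ (p = 0 \/ q = 0)].
Proof.
move=> pq0; have [qp|pq] := leP `|q| `|p|.
  have p0 : p != 0.
    apply: contra_neq pq0 => p0; move: qp; rewrite p0 normr0 normr_le0 => /eqP ->.
    by [].
  have [F [FE F0 Fle Feq]] := @mean_affine_bound_dominant p q c p0 qp.
  by exists F; split => // /Feq[-> ->]; split => //; right.
have q0 : q != 0 by rewrite -normr_gt0 (le_lt_trans _ pq).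
have [F [FE F0 Fle Feq]] := @mean_affine_bound_dominant q p c q0 (ltW pq).
rewrite mean_affineC [p ^+ 2 + _]addrC; exists F; split => // /Feq[-> ->].
by split => //; left.
Qed.

End Bound.

(** * Distortion of sets of at most two points *)

Section Distortion.
Context {R : realType}.
Local Notation P := (@uniform_square R : probability (plane R) R).

Lemma sqdistE (x a : R * R) : sqdist x a = (x.1 - a.1) ^+ 2 + (x.2 - a.2) ^+ 2.
Proof. by rewrite /sqdist /euclid_norm sqr_sqrtr// addr_ge0 ?sqr_ge0. Qed.

Lemma distortion_fset2 (Q : probability (plane R) R) (a b : R * R) :
  distortion Q [fset a; b]%fset =
  (\int[Q]_x (Num.min (sqdist x a) (sqdist x b))%:E)%E.
Proof.
apply: eq_integral => x _; have [->|ab] := eqVneq a b.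
  by rewrite fsetUid big_seq_fset1 minxx.
by rewrite big_fsetU1 ?inE// big_seq_fset1 EFin_min.
Qed.

(** A singleton is written as a pair with a = b, so that only the empty set stands apart. *)
Lemma fset_card_le2P (K : choiceType) (A : {fset K}) : (#|` A| <= 2)%N ->
  A = fset0 \/ exists a b, A = [fset a; b]%fset.
Proof.
have [->|/fset0Pn[a aA]] := eqVneq A fset0; first by left.
rewrite (cardfsD1 a) aA ltnS => A1; right.
have [A0|A0] := eqVneq (A `\ a)%fset fset0.
  by exists a, a; rewrite -(fsetD1K aA) A0 fsetU0 fsetUid.
have /cardfs1P[b Ab] : #|` A `\ a|%fset == 1%N by rewrite eqn_leq A1 cardfs_gt0.
by exists a, b; rewrite -(fsetD1K aA) Ab.
Qed.

Lemma distortion_fset0 (Q : probability (plane R) R) :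
  distortion Q fset0 = +oo%E.
Proof.
rewrite /distortion; under eq_integral do rewrite big_seq_fset0.
by rewrite integral_cst//= probability_setT mule1.
Qed.

(** Parallel axis theorem: each coordinate has variance 1/12, whence 1/6. The constant [w] will be
    |d|^2. *)
Lemma integral_sqdist (a : R * R) (w : R) : 0 <= w ->
  (\int[P]_z (sqdist z a + w)%:E =
   (1 / 6 + sqdist (2^-1, 2^-1) a + w)%:E)%E.
Proof.
move=> w0.
have sq0 z : 0 <= sqdist z a + w by rewrite addr_ge0// sqr_ge0.
rewrite integral_uniform_square1//; last first.
  apply/measurable_EFinP/measurable_funD => //.
  under eq_fun do rewrite sqdistE.
  by apply: measurable_funD; apply: measurable_funX; apply: measurable_funB.
pose k (x : R) := 12^-1 + (a.2 - 2^-1) ^+ 2 + w + (x - a.1) ^+ 2.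
transitivity (\int[@uniform_prob R 0 1 ltr01]_x (k x)%:E)%E.
  apply: eq_integral => x _.
  pose v : R := - 2 * (a.2 - 2^-1).
  pose l : R := (a.2 - 2^-1) ^+ 2 + w + (x - a.1) ^+ 2.
  have E y : sqdist (x, y) a + w = 1 * (y - 2^-1) ^+ 2 + v * (y - 2^-1) + l.
    by rewrite sqdistE/= /v /l; field.
  under eq_integral do rewrite E.
  rewrite integral_uniform_quadratic; last by move=> y; rewrite -E.
  by congr EFin; rewrite /l /k; field.
pose v : R := - 2 * (a.1 - 2^-1).
pose l : R := 12^-1 + (a.2 - 2^-1) ^+ 2 + w + (a.1 - 2^-1) ^+ 2.
have E x : k x = 1 * (x - 2^-1) ^+ 2 + v * (x - 2^-1) + l.
  by rewrite /v /l /k; field.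
have k0 x : 0 <= k x by rewrite /k !addr_ge0 ?sqr_ge0// invr_ge0.
under eq_integral do rewrite E.
rewrite integral_uniform_quadratic; last by move=> y; rewrite -E.
by congr EFin; rewrite /l sqdistE /=; field.
Qed.

(** Here (p, q) is d and (u, v) is the offset of the midpoint from the center. The term 2 F stands
    on the left so that only integrals of nonnegative functions are added. *)
Lemma distortionD_mean_affine (a b : R * R) (p q u v : R) :
  a = (2^-1 + u - p, 2^-1 + v - q) -> b = (2^-1 + u + p, 2^-1 + v + q) ->
  (distortion P [fset a; b]%fset + 2%:E * mean_affine p q (- (u * p + v * q)) =
   (1 / 6 + (u ^+ 2 + v ^+ 2) + (p ^+ 2 + q ^+ 2))%:E)%E.
Proof.
move=> aE bE; rewrite distortion_fset2.
pose m : R * R := (2^-1 + u, 2^-1 + v).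
pose Y (z : R * R) := p * (z.1 - 2^-1) + q * (z.2 - 2^-1) - (u * p + v * q).
have mY : measurable_fun [set: plane R] (fun z : plane R => `|Y z|).
  exact: measurable_norm_affine.
have ms : measurable_fun [set: plane R] (fun z : plane R => sqdist z m).
  under eq_fun do rewrite sqdistE.
  by apply: measurable_funD; apply: measurable_funX; apply: measurable_funB.
have minE (z : R * R) : Num.min (sqdist z a) (sqdist z b) =
    sqdist z m + (p ^+ 2 + q ^+ 2) - 2 * `|Y z|.
  have -> : sqdist z a = sqdist z m + (p ^+ 2 + q ^+ 2) + 2 * Y z.
    by rewrite !sqdistE aE /m /Y/=; field.
  have -> : sqdist z b = sqdist z m + (p ^+ 2 + q ^+ 2) - 2 * Y z.
    by rewrite !sqdistE bE /m /Y/=; field.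
  have [Y0|Y0] := leP 0 (Y z).
    by rewrite min_r ?ger0_norm//; lra.
  by rewrite min_l ?ltr0_norm//; lra.
have min0 z : 0 <= Num.min (sqdist z a) (sqdist z b) by rewrite le_min !sqr_ge0.
rewrite /mean_affine -ge0_integralZl//; last first.
  exact/measurable_EFinP.
rewrite -ge0_integralD//=; last 3 first.
- by move=> z _; rewrite lee_fin.
- apply/measurable_EFinP; under eq_fun do rewrite minE.
  apply: measurable_funB; first exact: measurable_funD.
  exact: measurable_funM.
- by apply/measurable_EFinP; exact: measurable_funM.
transitivity (\int[P]_z (sqdist z m + (p ^+ 2 + q ^+ 2))%:E)%E.
  by apply: eq_integral => z _; rewrite -EFinM -EFinD minE subrK.
rewrite integral_sqdist ?addr_ge0 ?sqr_ge0//; congr EFin.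
by rewrite sqdistE/=; field.
Qed.

Lemma distortion_mean_affine (a b : R * R) (p q u v F : R) :
  a = (2^-1 + u - p, 2^-1 + v - q) -> b = (2^-1 + u + p, 2^-1 + v + q) ->
  mean_affine p q (- (u * p + v * q)) = F%:E ->
  distortion P [fset a; b]%fset =
   (1 / 6 + (u ^+ 2 + v ^+ 2) + (p ^+ 2 + q ^+ 2) - 2 * F)%:E.
Proof.
move=> aE bE FE; have := distortionD_mean_affine _ _ _ _ _ _ aE bE.
rewrite FE -EFinM.
by case: (distortion _ _) => [D| |]// [<-]; rewrite addrK.
Qed.

Lemma distortion_fset2_ge (a b : R * R) :
  exists D, [/\ distortion P [fset a; b]%fset = D%:E, 5 / 48 <= D &
   D = 5 / 48 -> [fset a; b]%fset = [fset (1/4, 1/2); (3/4, 1/2)]%fset \/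
                 [fset a; b]%fset = [fset (1/2, 1/4); (1/2, 3/4)]%fset].
Proof.
case: a b => [a1 a2] [b1 b2].
pose p := (b1 - a1) / 2; pose q := (b2 - a2) / 2.
pose u := (a1 + b1) / 2 - 2^-1; pose v := (a2 + b2) / 2 - 2^-1.
have aE : (a1, a2) = (2^-1 + u - p, 2^-1 + v - q).
  by congr (_, _); rewrite /u /p /v /q; field.
have bE : (b1, b2) = (2^-1 + u + p, 2^-1 + v + q).
  by congr (_, _); rewrite /u /p /v /q; field.
have distE F := distortion_mean_affine _ _ _ _ _ _ F aE bE.
move: p q u v aE bE distE => p q u v -> -> {a1 a2 b1 b2}.
set c := - (_ + _) => distE.
have uv0 : 0 <= u ^+ 2 + v ^+ 2 by rewrite addr_ge0 ?sqr_ge0.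
(* If the two points coincide, the distortion is at least 1/6 > 5/48. *)
have [[p0 q0]|pq0] := eqVneq (p, q) 0.
  have /distE -> : mean_affine p q c = 0%E.
    apply: integral0_eq => z _.
    by rewrite /c p0 q0 !(mul0r, mulr0, addr0, oppr0) normr0.
  exists (1 / 6 + (u ^+ 2 + v ^+ 2) + (p ^+ 2 + q ^+ 2) - 2 * 0).
  have pq0 : 0 <= p ^+ 2 + q ^+ 2 by rewrite addr_ge0 ?sqr_ge0.
  by split => //; [|move=> ?; exfalso]; lra.
have [F [/distE -> F0 Fle Feq]] := @mean_affine_bound R p q c pq0.
(* Lagrange's identity: Cauchy-Schwarz with its defect kept, for use in the equality case. *)
have : c ^+ 2 + (u * q - v * p) ^+ 2 = (p ^+ 2 + q ^+ 2) * (u ^+ 2 + v ^+ 2).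
  by rewrite /c; ring.
have lag0 := sqr_ge0 (u * q - v * p).
move: Fle Feq uv0; set N := p ^+ 2 + q ^+ 2; set M := u ^+ 2 + v ^+ 2.
have N0 : 0 <= N by rewrite addr_ge0 ?sqr_ge0.
move=> Fle Feq M0 lag.
exists (1 / 6 + M + N - 2 * F); split => //.
  suff : 2 * F <= N + M + 1 / 16 by lra.
  rewrite -ler_sqr ?nnegrE; [|lra|lra].
  (* 4 F^2 <= 4 c^2 + N / 4 <= 4 N (M + 1/16) <= (N + M + 1/16)^2, the last step by AM-GM. *)
  by have := sqr_ge0 (N - M - 1 / 16); nra.
move=> D5; have F2 : 2 * F = N + M + 1 / 16 by lra.
(* A sum of nonnegative terms: the defects in AM-GM, in the bound on F and in
   Cauchy-Schwarz all vanish. *)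
have sq : (N - M - 1 / 16) ^+ 2 + 4 * (c ^+ 2 + N / 16 - F ^+ 2) +
    4 * (u * q - v * p) ^+ 2 = 0.
  have -> : (u * q - v * p) ^+ 2 = N * M - c ^+ 2 by lra.
  have -> : F ^+ 2 = (N + M + 1 / 16) ^+ 2 / 4 by rewrite -F2; field.
  by field.
have sq0 := sqr_ge0 (N - M - 1 / 16).
have /Feq [c0 pq] : F ^+ 2 = c ^+ 2 + N / 16 by lra.
have uqvp : u * q - v * p = 0 by apply/eqP; rewrite -sqrf_eq0; apply/eqP; lra.
have NM : N - M - 1 / 16 = 0 by apply/eqP; rewrite -sqrf_eq0; apply/eqP; lra.
have NM0 : N * M = 0 by rewrite -lag c0 uqvp expr0n addr0.
(* N = M + 1/16 is positive, so the other factor vanishes: the midpoint is the center, and N =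
   1/16. *)
have {}M0 : M = 0.
  by move/eqP: NM0; rewrite mulf_eq0 => /orP[|] /eqP // ?; lra.
have u0 : u = 0.
  apply/eqP; rewrite -sqrf_eq0 eq_le sqr_ge0 andbT.
  by have := sqr_ge0 v; rewrite /M in M0; lra.
have v0 : v = 0.
  apply/eqP; rewrite -sqrf_eq0 eq_le sqr_ge0 andbT.
  by have := sqr_ge0 u; rewrite /M in M0; lra.
have root (t : R) : t ^+ 2 = 1 / 16 -> t = 1 / 4 \/ t = - (1 / 4).
  move=> t2; have /eqP : (t - 1 / 4) * (t + 1 / 4) = 0.
    by transitivity (t ^+ 2 - 1 / 16); [field|lra].
  by rewrite mulf_eq0 subr_eq0 addr_eq0 => /orP[] /eqP; [left|right].
rewrite u0 v0.
(* The nonzero coordinate of d is 1/4 or -1/4; the sign only exchanges the two points. *)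
case: pq => [p0|q0]; [right|left].
  have /root[] : q ^+ 2 = 1 / 16 by rewrite /N p0 in NM; lra.
    by move=> ->; rewrite p0; congr fsetU; congr fset1; congr (_, _); field.
  by move=> ->; rewrite p0 fsetUC; congr fsetU; congr fset1; congr (_, _); field.
have /root[] : p ^+ 2 = 1 / 16 by rewrite /N q0 in NM; lra.
  by move=> ->; rewrite q0; congr fsetU; congr fset1; congr (_, _); field.
by move=> ->; rewrite q0 fsetUC; congr fsetU; congr fset1; congr (_, _); field.
Qed.

Lemma mean_affine_axis (p : R) : mean_affine p 0 0 = (`|p| / 4)%:E.
Proof.
rewrite mean_affineE; under eq_integral do rewrite mul0r addr0.
rewrite integral_cst//= probability_setT mule1 /mean_norm normr0 ifT.
  by rewrite expr0n mul0r addr0.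
by rewrite divr_ge0.
Qed.

Lemma distortion_vertical_cut :
  distortion P [fset (1/4, 1/2); (3/4, 1/2)]%fset = (5 / 48)%:E.
Proof.
(* Midpoint at the center, d = (1/4, 0) and F = |d| / 4 = 1/16, whence 1/6 + 1/16 - 2/16 = 5/48. *)
rewrite (@distortion_mean_affine _ _ 4^-1 0 0 0 (4^-1 / 4)).
- by congr EFin; field.
- by congr (_, _); field.
- by congr (_, _); field.
- by rewrite !mul0r addr0 oppr0 mean_affine_axis ger0_norm.
Qed.

Lemma distortion_horizontal_cut :
  distortion P [fset (1/2, 1/4); (1/2, 3/4)]%fset = (5 / 48)%:E.
Proof.
rewrite (@distortion_mean_affine _ _ 0 4^-1 0 0 (4^-1 / 4)).
- by congr EFin; field.
- by congr (_, _); field.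
- by congr (_, _); field.
- by rewrite !mul0r addr0 oppr0 mean_affineC mean_affine_axis ger0_norm.
Qed.

End Distortion.

(** * The optimal sets of two-means and the quantization error *)

Theorem theorem3p3p1 (R : realType) :
  let P : probability (plane R) R := @uniform_square R in
  let alpha1 : {fset R * R} := [fset (1/4, 1/2); (3/4, 1/2)]%fset in
  let alpha2 : {fset R * R} := [fset (1/2, 1/4); (1/2, 3/4)]%fset in
  [/\ optimal_means 2 P = [set alpha1; alpha2],
      alpha1 <> alpha2 &
      quantization_error 2 P = (5 / 48)%:E].
Proof.
move=> P alpha1 alpha2.
have card1 : (#|` alpha1| <= 2)%N by rewrite cardfs2; case: (_ != _).
have card2 : (#|` alpha2| <= 2)%N by rewrite cardfs2; case: (_ != _).
have V : quantization_error 2 P = (5 / 48)%:E.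
  apply/eqP; rewrite eq_le; apply/andP; split.
    apply: ereal_inf_lbound; exists alpha1 => //.
    exact: distortion_vertical_cut.
  apply: le_ereal_inf_tmp => _ [alpha /fset_card_le2P[->|[a [b ->]]] <-].
    by rewrite distortion_fset0 leey.
  by have [D [-> ? _]] := distortion_fset2_ge a b; rewrite lee_fin.
split => //; last first.
  (* The point (1/4, 1/2) separates the two sets. *)
  move=> /fsetP /(_ (1/4, 1/2)); rewrite !inE eqxx /= => /esym /orP[] /eqP[]; lra.
rewrite /optimal_means V; apply/seteqP; split => alpha /=.
  (* An optimal set is nonempty, its distortion being finite, and attains 5/48, so the equality case
     identifies it. *)
  move=> [/fset_card_le2P[->|[a [b ->]]]]; first by rewrite distortion_fset0.
  by have [D [-> _ Deq]] := distortion_fset2_ge a b; move=> [/Deq].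
move=> [->|->]; split => //.
  exact: distortion_vertical_cut.
exact: distortion_horizontal_cut.
Qed.
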